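(* Let $\tilde{\mathfrak K}$ be a Hilbert space and $\tilde A,\tilde B$ bounded doubly infinite Toeplitz operators on $L^2(\tilde{\mathfrak K})$ (not necessarily of finite degree), and suppose the set $\tilde{\mathcal M}=\{M:\begin{pmatrix}\tilde A-M&\tilde B^*\\\tilde B&M\end{pmatrix}\ge0\}$ is not empty. Then there exists a doubly infinite Toeplitz operator $\hat A\le\tilde A$ such that $\hat{\mathcal M}=\{M:\begin{pmatrix}\hat A-M&\tilde B^*\\\tilde B&M\end{pmatrix}\ge0\}=\{\hat M\}$ is a singleton. In this case $\hat M$ is a bounded doubly infinite Toeplitz operator.
   Context: $L^2(\tilde{\mathfrak K})=\bigoplus_{-\infty}^{\infty}\tilde{\mathfrak K}$; a doubly infinite Toeplitz operator is a bounded operator on it with block matrix entries $X_{j,k}=X_{j-k}$ (equivalently commuting with the bilateral shift). $M$ ranges over bounded operators on $L^2(\tilde{\mathfrak K})$; ''$\ge0$'' means positive semidefinite. *)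

(* Defs.v *)
From HB Require Import structures.
From mathcomp Require Import all_boot all_order all_algebra.
From mathcomp Require Import complex.
From mathcomp Require Import reals.
Set Implicit Arguments. Unset Strict Implicit. Unset Printing Implicit Defensive.
Import Order.TTheory GRing.Theory Num.Theory.
Local Open Scope ring_scope.
Local Open Scope complex_scope.

Section Defs.
Variable R : realType.
Local Notation C := R[i].
Variable K : lmodType C.
Variable ip : K -> K -> C.

Definition is_inner_product :=
  [/\ forall x y z, ip (x + y) z = ip x z + ip y z,
      forall (a : C) x y, ip (a *: x) y = a * ip x y,
      forall x y, ip y x = (ip x y)^*,
      forall x, 0 <= ip x x
    & forall x, ip x x = 0 -> x = 0].

Definition nrm2 (x : K) : R := complex.Re (ip x x).

Definition is_complete :=
  forall u : nat -> K,
    (forall e : R, 0 < e -> exists N, forall m n, (N <= m)%N -> (N <= n)%N ->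
        nrm2 (u m - u n) < e ^+ 2) ->
    exists l, forall e : R, 0 < e -> exists N, forall n, (N <= n)%N ->
        nrm2 (u n - l) < e ^+ 2.

Definition is_hilbert := is_inner_product /\ is_complete.

Definition seqZ := int -> K.

Definition psumR (f : int -> R) (N : nat) : R :=
  \sum_(i < (N.*2).+1) f (i%:Z - N%:Z).
Definition psumC (f : int -> C) (N : nat) : C :=
  \sum_(i < (N.*2).+1) f (i%:Z - N%:Z).

Definition inL2 (x : seqZ) : Prop :=
  exists S : R, forall N, psumR (fun n => nrm2 (x n)) N <= S.

Definition ip2 (x y : seqZ) (s : C) : Prop :=
  forall e : C, 0 < e -> exists N0, forall N, (N0 <= N)%N ->
    `| psumC (fun n => ip (x n) (y n)) N - s | < e.

(* operators are maps on sequences, considered on L^2 *)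
Definition op := seqZ -> seqZ.

Definition subop (A M : op) : op := fun x n => A x n - M x n.

Definition bounded_op (T : op) : Prop :=
  [/\ forall x, inL2 x -> inL2 (T x),
      forall (a : C) x y, inL2 x -> inL2 y ->
        T (fun n => a *: x n + y n) = (fun n => a *: T x n + T y n)
    & exists c : R, forall x, inL2 x -> forall S : R,
        (forall N, psumR (fun n => nrm2 (x n)) N <= S) ->
        forall N, psumR (fun n => nrm2 (T x n)) N <= c * S].

Definition shift (x : seqZ) : seqZ := fun n => x (n - 1).

Definition toeplitz (T : op) : Prop :=
  bounded_op T /\ forall x, inL2 x -> T (shift x) = shift (T x).

Definition psd (T : op) : Prop :=
  forall x, inL2 x -> forall s, ip2 (T x) x s -> 0 <= s.

Definition op_eq (T1 T2 : op) : Prop := forall x, inL2 x -> T1 x = T2 x.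

(* [[A - M, B^*], [B, M]] >= 0 on L^2(K) (+) L^2(K): for z = (x, y),
   < (A-M)x + B^* y, x > + < B x + M y, y >
   = <(A-M)x,x> + conj <B x, y> + <B x, y> + <M y, y> >= 0 *)
Definition block_psd (A B M : op) : Prop :=
  forall x y, inL2 x -> inL2 y -> forall a b d,
    ip2 (subop A M x) x a -> ip2 (B x) y b -> ip2 (M y) y d ->
    0 <= a + b^* + b + d.

Definition Mset (A B : op) (M : op) : Prop := bounded_op M /\ block_psd A B M.

End Defs.

(* Main.v *)
Require Import Defs.
From HB Require Import structures.
From mathcomp Require Import all_boot all_order all_algebra.
From mathcomp Require Import complex.
From mathcomp Require Import boolp classical_sets functions reals.
From mathcomp Require Import ring lra zify.
(** Everything is phrased with real quadratic forms on $L^2$, invariant under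
    the scalars (up to the factor $|c|^2$) and under the shift.  For a form $a$
    the set of $M$ has a largest element $m_+$, namely the infimum over finite
    chains $x = u_0, u_1, \dots, u_n = 0$ of
    $\sum_i a(u_i) + 2\,\mathrm{Re}\langle Bu_i, u_{i+1}\rangle$, and, exchanging
    the two coordinates, a smallest element $m_-$; both inherit the symmetries
    of $a$.  Let $m$ be their midpoint and replace $a$ by $a - D$, where $D$ is
    the Schur complement of the block form of $(a, m)$.  Where $D$ is small, some
    $y$ nearly annihilates $(x,y)$ in the block forms of both $(a, m_+)$ and
    $(a, m_-)$; comparing first rows shows that $m_+(x) - m_-(x)$ is small.
    Iterating yields a decreasing sequence $a_k$ with $D_k \to 0$, so the set for
    $\hat a = \inf_k a_k$ is a singleton.  Bounded forms are turned back into
    operators by Jordan–von Neumann and Riesz, and uniqueness of the operator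
    transports the invariance. *)
Set Implicit Arguments. Unset Strict Implicit. Unset Printing Implicit Defensive.
Import Order.TTheory GRing.Theory Num.Theory.
Local Open Scope ring_scope.
Local Open Scope complex_scope.

(** * Invariant quadratic forms, extremal admissible forms and the tightening iteration *)

Section Forms.
Variables (R : realType) (H : zmodType) (sym : (H -> H) -> R -> Prop).
Hypothesis symD : forall g k, sym g k -> {morph g : x y / x + y}.
Hypothesis sym_gt0 : forall g k, sym g k -> 0 < k.
Hypothesis symV : forall g k, sym g k ->
  exists g' k', [/\ sym g' k', cancel g g', cancel g' g & k * k' = 1].
Hypothesis sym_muln : forall n, sym (fun x => x *+ n.+1) (n.+1%:R ^+ 2).

(** [sym g k] is read as: the additive bijection [g] multiplies forms by [k]. On $L^2$ the scalars
    $c \ne 0$ occur with $k = |c|^2$ and both shifts with $k = 1$, so that homogeneity and Toeplitz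
    invariance become one clause. *)
Definition qform (q : H -> R) :=
  (forall x y, q (x + y) + q (x - y) = 2 * (q x + q y)) /\
  (forall g k, sym g k -> forall x, q (g x) = k * q x).

Definition bform (b : H -> H -> R) :=
  [/\ forall x x' y, b (x + x') y = b x y + b x' y,
      forall x y y', b x (y + y') = b x y + b x y'
    & forall g k, sym g k -> forall x y, b (g x) (g y) = k * b x y].

(** The real part of block positivity. Here [m] is an arbitrary function, so maximality and
    uniqueness below hold against all competitors vanishing at 0, also those without shift
    invariance. *)
Definition adm (a : H -> R) (b : H -> H -> R) (m : H -> R) :=
  forall x y, 0 <= a x - m x + 2 * b x y + m y.

Lemma sym0 g k : sym g k -> g 0 = 0.
Proof. by move=> /symD gD; apply: (addIr (g 0)); rewrite -gD !add0r. Qed.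

Lemma symB g k : sym g k -> {morph g : x y / x - y}.
Proof.
move=> gk x y; have gD := symD gk; apply: (addIr (g y)).
by rewrite -gD !subrK.
Qed.

Lemma qform0 q : qform q -> q 0 = 0.
Proof. by case=> /(_ 0 0); rewrite addr0 subr0 => h _; lra. Qed.

Lemma qform_muln q n x : qform q -> q (x *+ n) = n%:R ^+ 2 * q x.
Proof.
move=> qq; case: n => [|n]; first by rewrite mulr0n (qform0 qq) expr0n mul0r.
by case: qq => _ /(_ _ _ (sym_muln n)).
Qed.

(** Both inequalities reverse themselves: the second through the inverse symmetry, the first by
    substituting $(x+y, x-y)$ and using $q(2x) = 4q(x)$. *)
Lemma qform_le q :
    (forall x y, q (x + y) + q (x - y) <= 2 * (q x + q y)) ->
    (forall g k, sym g k -> forall x, q (g x) <= k * q x) -> qform q.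
Proof.
move=> qD qG; have qE g k : sym g k -> forall x, q (g x) = k * q x.
  move=> gk x; apply/le_anti; rewrite qG //=.
  have [g' [k' [gk' gK _ kk']]] := symV gk.
  have k0 := sym_gt0 gk.
  have := qG _ _ gk' (g x); rewrite gK => h.
  have : k * q x <= k * (k' * q (g x)) by rewrite ler_pM2l.
  by rewrite mulrA kk' mul1r.
split=> // x y; apply/le_anti; rewrite qD /=.
have := qD (x + y) (x - y).
rewrite addrACA subrr addr0 -mulr2n opprB [x + y + _]addrC addrA subrK -mulr2n.
by rewrite !(qE _ _ (sym_muln 1)) => h; lra.
Qed.

Lemma qformD q q' : qform q -> qform q' -> qform (fun x => q x + q' x).
Proof.
move=> [qD qG] [qD' qG']; split=> [x y|g k gk x].
  by have := qD x y; have := qD' x y; lra.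
by rewrite (qG _ _ gk) (qG' _ _ gk) mulrDr.
Qed.

Lemma qformZ c q : qform q -> qform (fun x => c * q x).
Proof.
move=> [qD qG]; split=> [x y|g k gk x]; first by rewrite -mulrDr qD; ring.
by rewrite (qG _ _ gk); ring.
Qed.

Lemma qformB q q' : qform q -> qform q' -> qform (fun x => q x - q' x).
Proof.
move=> hq /(qformZ (-1)) /(qformD hq).
by under eq_fun do rewrite mulN1r.
Qed.

(** Serves for the largest admissible form, the Schur complement and both limit forms. Combining
    values over [x] and [y] into values over [x + y] and [x - y] gives the infimum the parallelogram
    inequality, and [qform_le] does the rest. *)
Lemma qform_inf (S : H -> set R) :
    (forall x, exists r, S x r) -> (forall x r, S x r -> 0 <= r) ->
    (forall x y r s, S x r -> S y s -> exists r' s',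
       [/\ S (x + y) r', S (x - y) s' & r' + s' <= 2 * (r + s)]) ->
    (forall g k, sym g k -> forall x r, S x r ->
       exists2 r', S (g x) r' & r' <= k * r) ->
  exists q, [/\ qform q, forall x r, S x r -> q x <= r
    & forall x c, (forall r, S x r -> c <= r) -> c <= q x].
Proof.
move=> Sn S0 SD SG; exists (fun x => inf (S x)).
have lbS x r : S x r -> inf (S x) <= r.
  by move=> Sxr; apply: ge_inf => //; exists 0 => s; apply: S0.
have glbS x c : (forall r, S x r -> c <= r) -> c <= inf (S x).
  by move=> h; apply: lb_le_inf => //; have [r ?] := Sn x; exists r.
split=> //; apply: qform_le => [x y|g k gk x].
  set L := _ + _; suff : L / 2 - inf (S y) <= inf (S x) by lra.
  apply: (glbS) => r Sr; suff : L / 2 - r <= inf (S y) by lra.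
  apply: (glbS) => s Ss; have [r' [s' [Sr' Ss' le]]] := SD _ _ _ _ Sr Ss.
  by have := lbS _ _ Sr'; have := lbS _ _ Ss'; rewrite /L; lra.
have k0 := sym_gt0 gk.
rewrite mulrC -ler_pdivrMr //; apply: (glbS) => r Sr; rewrite ler_pdivrMr // mulrC.
by have [r' Sr' le] := SG _ _ gk _ _ Sr; apply: le_trans (lbS _ _ Sr') le.
Qed.

Lemma bformBl b x x' y : bform b -> b (x - x') y = b x y - b x' y.
Proof. by move=> [bl _ _]; have := bl (x - x') x' y; rewrite subrK; lra. Qed.

Lemma bformBr b x y y' : bform b -> b x (y - y') = b x y - b x y'.
Proof. by move=> [_ br _]; have := br x (y - y') y'; rewrite subrK; lra. Qed.

Lemma bform0l b y : bform b -> b 0 y = 0.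
Proof. by move=> hb; have := bformBl 0 0 y hb; rewrite subr0; lra. Qed.

Lemma bform0r b x : bform b -> b x 0 = 0.
Proof. by move=> hb; have := bformBr x 0 0 hb; rewrite subr0; lra. Qed.

Lemma bform_muln b x y n p : bform b -> b (x *+ n) (y *+ p) = n%:R * p%:R * b x y.
Proof.
move=> hb; have [bl br _] := hb.
have E z : b z (y *+ p) = p%:R * b z y.
  elim: p => [|p IH]; first by rewrite mulr0n bform0r // mul0r.
  by rewrite mulrSr br IH mulrSr; ring.
rewrite E; elim: n => [|n IH]; first by rewrite mulr0n bform0l //; ring.
by rewrite mulrSr bl mulrDr IH mulrSr; ring.
Qed.

Lemma bform_swap b : bform b -> bform (fun x y => b y x).
Proof. by move=> [bl br bG]; split=> [? ? ?|? ? ?|? ? gk ? ?]; rewrite ?br ?bl ?(bG _ _ gk). Qed.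

Lemma bform_parallelogram b x x' y y' : bform b ->
  b (x + x') (y + y') + b (x - x') (y - y') = 2 * (b x y + b x' y').
Proof.
move=> hb; have [bl br _] := hb.
by rewrite bformBl // !bformBr // bl !br; ring.
Qed.

Lemma adm_ge0 a b m : qform a -> bform b -> m 0 = 0 -> adm a b m ->
  forall y, 0 <= m y.
Proof.
by move=> qa hb m0 adm_m y; have := adm_m 0 y; rewrite m0 (qform0 qa) bform0l //; lra.
Qed.

Lemma adm_le a b m : bform b -> m 0 = 0 -> adm a b m -> forall x, m x <= a x.
Proof. by move=> hb m0 adm_m x; have := adm_m x 0; rewrite m0 bform0r //; lra. Qed.

(** A chain is an infinite sequence with a cut-off [n], so that two chains can be added termwise
    once they are extended by 0 to a common length. *)
Definition chain_sum (a : H -> R) (b : H -> H -> R) (u : nat -> H) n : R :=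
  \sum_(i < n) (a (u i) + 2 * b (u i) (u i.+1)).

Lemma chain_sum_ext a b u n p : qform a -> bform b ->
  (forall i, (n <= i)%N -> u i = 0) -> (n <= p)%N ->
  chain_sum a b u p = chain_sum a b u n.
Proof.
move=> qa hb un /subnK <-; elim: (p - n)%N => // d; rewrite addSn => <-.
rewrite /chain_sum big_ord_recr /= un ?leq_addl // (qform0 qa) bform0l //.
by rewrite mulr0 !addr0.
Qed.

(** Admissibility at $(u_i, u_{i+1})$ bounds $m(u_i) - m(u_{i+1})$ by the $i$-th summand, and the
    differences telescope. *)
Lemma adm_chain_sum a b m u n : adm a b m -> m (u 0%N) - m (u n) <= chain_sum a b u n.
Proof.
move=> adm_m; elim: n => [|n IH]; first by rewrite subrr /chain_sum big_ord0.
rewrite /chain_sum big_ord_recr /= -/(chain_sum a b u n).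
by have := adm_m (u n) (u n.+1); lra.
Qed.

Definition max_adm a b mp :=
  [/\ qform mp, adm a b mp & forall m, m 0 = 0 -> adm a b m -> forall x, m x <= mp x].

(** By telescoping, the infimum over chains ending at 0 dominates every admissible function; the
    given [m], which is nonnegative, bounds the chain sums from below. *)
Lemma max_adm_exists a b m : qform a -> bform b -> m 0 = 0 -> adm a b m ->
  exists mp, max_adm a b mp.
Proof.
move=> qa hb m0 adm_m.
have m_ge0 := adm_ge0 qa hb m0 adm_m.
pose S x : set R := fun r => exists u n,
  [/\ u 0%N = x, forall i, (n <= i)%N -> u i = 0 & r = chain_sum a b u n].
have S_ge m' x r : m' 0 = 0 -> adm a b m' -> S x r -> m' x <= r.
  move=> m'0 adm_m' [u [n [<- un ->]]].
  by have := adm_chain_sum u n adm_m'; rewrite (un n) // m'0 subr0.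
have [qaD qaG] := qa.
have [||||mp [qmp mp_lb mp_glb]] := @qform_inf S.
- move=> x; exists (a x), (fun i => if i is 0%N then x else 0), 1%N; split=> //.
    by case.
  by rewrite /chain_sum big_ord1 /= bform0r // mulr0 addr0.
- by move=> x r /(S_ge _ _ _ m0 adm_m); apply: le_trans.
- move=> x y _ _ [u [n [<- un ->]]] [v [p [<- vp ->]]].
  set N := maxn n p.
  exists (chain_sum a b (fun i => u i + v i) N), (chain_sum a b (fun i => u i - v i) N).
  split.
  + exists (fun i => u i + v i), N; split=> // i.
    by rewrite geq_max => /andP[? ?]; rewrite un // vp // addr0.
  + exists (fun i => u i - v i), N; split=> // i.
    by rewrite geq_max => /andP[? ?]; rewrite un // vp // subr0.
  rewrite -(chain_sum_ext qa hb un (leq_maxl n p)).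
  rewrite -(chain_sum_ext qa hb vp (leq_maxr n p)) -/N.
  rewrite /chain_sum -!big_split mulr_sumr le_eqVlt; apply/orP; left; apply/eqP.
  apply: eq_bigr => i _ /=.
  have := qaD (u i) (v i).
  by have := bform_parallelogram (u i) (v i) (u i.+1) (v i.+1) hb; lra.
- move=> g k gk x _ [u [n [<- un ->]]].
  exists (chain_sum a b (g \o u) n).
    exists (g \o u), n; split=> // i ni /=; by rewrite un // (sym0 gk).
  rewrite /chain_sum mulr_sumr le_eqVlt; apply/orP; left; apply/eqP.
  apply: eq_bigr => i _ /=; rewrite (qaG _ _ gk).
  by have [_ _ /(_ _ _ gk) ->] := hb; ring.
exists mp; split=> //.
  move=> x y; suff : mp x - a x - 2 * b x y <= mp y by lra.
  apply: mp_glb => r [u [n [uy un ->]]].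
  (* Prepending [x] to a chain that starts at [y] adds exactly $a(x) + 2b(x,y)$ to its sum. *)
  suff : mp x <= chain_sum a b (fun i => if i is j.+1 then u j else x) n.+1.
    by rewrite /chain_sum big_ord_recl /= uy; lra.
  by apply: mp_lb; exists (fun i => if i is j.+1 then u j else x), n.+1; split=> // -[].
by move=> m' m'0 adm_m' x; apply: mp_glb => r; apply: S_ge.
Qed.

(* Swapping the two coordinates exchanges [m] with [a - m]. *)
Lemma adm_swap a b m : adm a b m -> adm a (fun x y => b y x) (fun x => a x - m x).
Proof. by move=> h x y; have := h y x; lra. Qed.

Lemma min_adm_exists a b m : qform a -> bform b -> m 0 = 0 -> adm a b m ->
  exists mn, [/\ qform mn, adm a b mn
    & forall m', m' 0 = 0 -> adm a b m' -> forall x, mn x <= m' x].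
Proof.
move=> qa hb m0 adm_m.
have [||||mp [qmp adm_mp mp_max]] := @max_adm_exists a (fun x y => b y x) (fun x => a x - m x).
- exact: qa.
- exact: bform_swap.
- by rewrite m0 (qform0 qa) subr0.
- exact: adm_swap.
exists (fun x => a x - mp x); split; first exact: qformB.
  by move=> x y; have := adm_mp y x; lra.
move=> m' m'0 adm_m' x.
suff : a x - m' x <= mp x by lra.
by apply: (mp_max (fun x => a x - m' x)); [rewrite m'0 (qform0 qa) subr0|exact: adm_swap].
Qed.

(* Evaluate the form at [(n x, n y)] shifted by [(x, 0)] on either side. *)
Lemma form_row_bound al b mu x y e n : qform al -> bform b -> qform mu ->
  (forall x y, 0 <= al x + 2 * b x y + mu y) ->
  al x + 2 * b x y + mu y <= e ->
  2 * n.+1%:R * `|al x + b x y| <= n.+1%:R ^+ 2 * e + al x.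
Proof.
move=> qal hb qmu pos le_e.
have E p : 0 <= p%:R ^+ 2 * al x + 2 * (p%:R * n.+1%:R * b x y) + n.+1%:R ^+ 2 * mu y.
  by have := pos (x *+ p) (y *+ n.+1); rewrite (qform_muln _ _ qal) (qform_muln _ _ qmu) bform_muln.
have h1 := E n; have h2 := E n.+2.
have le2 : n.+1%:R ^+ 2 * (al x + 2 * b x y + mu y) <= n.+1%:R ^+ 2 * e.
  by rewrite ler_wpM2l // exprn_ge0.
have ne : n.+2%:R = n.+1%:R + 1 :> R by rewrite -[n.+2]addn1 natrD.
have ne' : n%:R = n.+1%:R - 1 :> R by rewrite -[n.+1]addn1 natrD addrK.
(* With $N = n+1$ and $F$ the value of the form at $(x,y)$, the two evaluations together say
   $2N|al(x) + b(x,y)| \le N^2F + al(x)$. *)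
move: h1 h2; rewrite ne ne'; move: (n.+1%:R : R) le2 => N le2 h1 h2.
by case: (ger0P (al x + b x y)) => _; nra.
Qed.

(** The invariant of the iteration; after a step, the midpoint form of that step is the witness for
    [m]. *)
Definition good a b := qform a /\ exists2 m, qform m & adm a b m.

(** Divided by $N = n+1$, the last estimate reads $m_1 - m_2 \le 2N(a - a') + a/N$: admissible
    functions are close at [x] when [N] is large and the step lowers [a x] little compared with
    $1/N$. *)
Lemma adm_step a b : good a b -> bform b ->
  exists a', [/\ good a' b, forall x, a' x <= a x
   & forall m1 m2, m1 0 = 0 -> m2 0 = 0 -> adm a b m1 -> adm a b m2 ->
     forall n x, n.+1%:R * (m1 x - m2 x) <= 2 * n.+1%:R ^+ 2 * (a x - a' x) + a x].
Proof.
move=> [qa [m qm adm_m]] hb; have m0 := qform0 qm.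
have [mp [qmp adm_mp mp_max]] := max_adm_exists qa hb m0 adm_m.
have [mn [qmn adm_mn mn_min]] := min_adm_exists qa hb m0 adm_m.
pose mid x := 2^-1 * (mp x + mn x).
have qmid : qform mid by apply/qformZ/qformD.
have adm_mid : adm a b mid.
  by move=> x y; have := adm_mp x y; have := adm_mn x y; rewrite /mid; lra.
have [qaD qaG] := qa; have [qmD qmG] := qmid.
pose S x : set R := fun r => exists y, r = a x - mid x + 2 * b x y + mid y.
have [||||D [qD D_lb D_glb]] := @qform_inf S.
- by move=> x; exists (a x - mid x + 2 * b x 0 + mid 0), 0.
- by move=> x r [y ->].
- move=> x x' _ _ [y ->] [y' ->]; do 2!eexists; split.
  + by exists (y + y').
  + by exists (y - y').
  have := bform_parallelogram x x' y y' hb.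
  by have := qaD x x'; have := qmD x x'; have := qmD y y'; lra.
- move=> g k gk x _ [y ->]; eexists; first by exists (g y).
  have [_ _ /(_ _ _ gk) ->] := hb.
  by rewrite (qaG _ _ gk) !(qmG _ _ gk); lra.
have D_ge0 x : 0 <= D x by apply: D_glb => r [y ->].
exists (fun x => a x - D x); split.
- split; first exact: qformB.
  exists mid => // x y.
  by have : D x <= a x - mid x + 2 * b x y + mid y; [apply: D_lb; exists y|lra].
- by move=> x; rewrite gerBl.
move=> m1 m2 m10 m20 adm_m1 adm_m2 n x.
have N0 : 0 < n.+1%:R :> R by [].
have le1 : n.+1%:R * (m1 x - m2 x) <= n.+1%:R * (mp x - mn x).
  by rewrite ler_pM2l //; have := mp_max _ m10 adm_m1 x; have := mn_min _ m20 adm_m2 x; lra.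
apply: le_trans le1 _.
suff : (n.+1%:R * (mp x - mn x) - a x) / (2 * n.+1%:R ^+ 2) <= D x.
  by rewrite ler_pdivrMr ?mulr_gt0 ?exprn_gt0 //; lra.
apply: D_glb => _ [y ->].
rewrite ler_pdivrMr ?mulr_gt0 ?exprn_gt0 //.
set r := _ - _ + _ + _.
(* Both block values on the right are nonnegative, so each is at most $2r$; this is the [e] passed
   to [form_row_bound]. *)
have rE : 2 * r = (a x - mp x + 2 * b x y + mp y) + (a x - mn x + 2 * b x y + mn y).
  by rewrite /r /mid; lra.
have := adm_mp x y; have := adm_mn x y => hn hp.
have b1 : 2 * n.+1%:R * `|a x - mp x + b x y| <= n.+1%:R ^+ 2 * (2 * r) + (a x - mp x).
  apply: (form_row_bound n (qformB qa qmp) hb qmp) => [*|]; [exact: adm_mp|rewrite /= rE; lra].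
have b2 : 2 * n.+1%:R * `|a x - mn x + b x y| <= n.+1%:R ^+ 2 * (2 * r) + (a x - mn x).
  apply: (form_row_bound n (qformB qa qmn) hb qmn) => [*|]; [exact: adm_mn|rewrite /= rE; lra].
(* Subtracting the two first rows cancels $a(x) + b(x,y)$ and leaves [mp x - mn x]. *)
have t1 : 2 * n.+1%:R * - (a x - mp x + b x y) <= 2 * n.+1%:R * `|a x - mp x + b x y|.
  by rewrite ler_pM2l ?mulr_gt0 // -normrN ler_norm.
have t2 : 2 * n.+1%:R * (a x - mn x + b x y) <= 2 * n.+1%:R * `|a x - mn x + b x y|.
  by rewrite ler_pM2l ?mulr_gt0 // ler_norm.
have := adm_ge0 qa hb (qform0 qmp) adm_mp x.
have := adm_ge0 qa hb (qform0 qmn) adm_mn x.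
by lra.
Qed.

(** Drops of at least [e] at every step would eventually make the sequence negative. *)
Lemma decr_small_step (s : nat -> R) e : (forall k, 0 <= s k) -> 0 < e ->
  exists k, s k - s k.+1 < e.
Proof.
move=> s0 e0; apply: contrapT => /forallNP hk.
have dec k : s k <= s 0%N - k%:R * e.
  elim: k => [|k IH]; first by rewrite mul0r subr0.
  by have /negP := hk k; rewrite -leNgt => h; rewrite mulrSr mulrDl mul1r; lra.
have [k] : exists k : nat, s 0%N / e < k%:R.
  by exists (Num.bound (s 0%N / e)); apply: archi_boundP; rewrite divr_ge0 // ltW.
by rewrite ltr_pdivrMr // => h; have := dec k; have := s0 k; lra.
Qed.

(** Here [ah] is the infimum of the iterates and [mh] the infimum of their largest admissible forms.
    Whatever is admissible for [ah] is admissible for every iterate, so the estimate of each step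
    applies to it. *)
Theorem tight_form_exists a b m : qform a -> bform b -> m 0 = 0 -> adm a b m ->
  exists ah mh, [/\ qform ah, qform mh, forall x, ah x <= a x, adm ah b mh
    & forall m', m' 0 = 0 -> adm ah b m' -> forall x, m' x = mh x].
Proof.
move=> qa hb m0 adm_m.
have ga : good a b.
  split=> //; have [mp [? ? _]] := max_adm_exists qa hb m0 adm_m; by exists mp.
(* Pairing a form with its proof of [good] lets [choice] produce a step function that can be
   iterated. *)
pose G := {a : H -> R | good a b}.
pose next (c d : G) := (forall x, sval d x <= sval c x) /\
    forall m1 m2, m1 0 = 0 -> m2 0 = 0 -> adm (sval c) b m1 -> adm (sval c) b m2 ->
     forall n x, n.+1%:R * (m1 x - m2 x)
       <= 2 * n.+1%:R ^+ 2 * (sval c x - sval d x) + sval c x.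
have [F FP] : {F : G -> G & forall c, next c (F c)}.
  apply: choice => -[c gc]; have [c' [gc' ? ?]] := adm_step gc hb.
  by exists (exist _ c' gc').
pose s k := sval (iter k F (exist _ a ga : G)).
have gs k : good (s k) b by rewrite /s; case: (iter _ _ _).
have qs k : qform (s k) by case: (gs k).
have s_dec k x : s k.+1 x <= s k x by have [+ _] := FP (iter k F (exist _ a ga)); apply.
have s_mono k l x : (k <= l)%N -> s l x <= s k x.
  by move=> /subnK <-; elim: (l - k)%N => // d IH; apply: le_trans IH; rewrite addSn.
have s_ge0 k x : 0 <= s k x.
  have [_ [mk qmk adm_mk]] := gs k; have mk0 := qform0 qmk.
  apply: le_trans (adm_le hb mk0 adm_mk x); exact: (adm_ge0 (qs k) hb mk0 adm_mk).
have smax k : exists mp, max_adm (s k) b mp.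
  have [_ [mk qmk adm_mk]] := gs k.
  exact: max_adm_exists (qs k) hb (qform0 qmk) adm_mk.
have adm_mono k l c : (k <= l)%N -> adm (s l) b c -> adm (s k) b c.
  by move=> kl h x y; have := h x y; have := s_mono k l x kl; lra.
have [||||ah [qah ah_lb ah_glb]] := @qform_inf (fun x r => exists k, r = s k x).
- by move=> x; exists (s 0%N x), 0%N.
- by move=> x r [k ->].
- move=> x y _ _ [k ->] [l ->]; set j := maxn k l.
  exists (s j (x + y)), (s j (x - y)); split; [by exists j|by exists j|].
  have [-> _] := qs j; rewrite ler_pM2l // lerD // s_mono //.
    exact: leq_maxl.
  exact: leq_maxr.
- move=> g k gk x _ [l ->]; exists (s l (g x)); first by exists l.
  by have [_ /(_ _ _ gk) ->] := qs l.
pose Sm x : set R := fun r => exists k mp, max_adm (s k) b mp /\ r = mp x.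
have Sm_mono k l mk ml : (k <= l)%N -> max_adm (s k) b mk -> max_adm (s l) b ml ->
    forall x, ml x <= mk x.
  move=> kl [_ _ mk_max] [qml adm_ml _] x.
  by apply: mk_max; [exact: qform0|exact: adm_mono adm_ml].
have [||||mh [qmh mh_lb mh_glb]] := @qform_inf Sm.
- by move=> x; have [mp hmp] := smax 0%N; exists (mp x), 0%N, mp.
- by move=> x r [k [mp [[qmp adm_mp _] ->]]]; apply: adm_ge0 (qs k) hb (qform0 qmp) adm_mp x.
- move=> x y _ _ [k [mk [hk ->]]] [l [ml [hl ->]]].
  have [mj hj] := smax (maxn k l).
  exists (mj (x + y)), (mj (x - y)); split.
  + by exists (maxn k l), mj.
  + by exists (maxn k l), mj.
  have [[-> _] _ _] := hj; rewrite ler_pM2l // lerD //.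
    by apply: Sm_mono hk hj _; exact: leq_maxl.
  by apply: Sm_mono hl hj _; exact: leq_maxr.
- move=> g k gk x _ [l [ml [hl ->]]]; exists (ml (g x)); first by exists l, ml.
  by have [[_ /(_ _ _ gk) ->] _ _] := hl.
have adm_ah : adm ah b mh.
  (* The indices approaching [ah x] and [mh y] are independent; as both families decrease, the
     largest form at index [maxn k l] settles the bound. *)
  move=> x y; suff : mh x - 2 * b x y - mh y <= ah x by lra.
  apply: ah_glb => _ [k ->]; suff : mh x - 2 * b x y - s k x <= mh y by lra.
  apply: mh_glb => _ [l [ml [hl ->]]].
  have [mj hj] := smax (maxn k l).
  have h1 : mh x <= mj x by apply: mh_lb; exists (maxn k l), mj.
  have h2 := Sm_mono _ _ _ _ (leq_maxr k l) hl hj y.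
  have h3 := s_mono _ _ x (leq_maxl k l).
  by have [_ /(_ x y) h _] := hj; lra.
exists ah, mh; split=> //; first by move=> x; apply: ah_lb; exists 0%N.
have uniq m1 m2 : m1 0 = 0 -> m2 0 = 0 -> adm ah b m1 -> adm ah b m2 ->
    forall x, m1 x <= m2 x.
  move=> m10 m20 adm1 adm2 x; rewrite leNgt; apply/negP => lt.
  have sub k c : adm ah b c -> adm (s k) b c.
    move=> h z y; have := h z y.
    by have : ah z <= s k z; [apply: ah_lb; exists k|lra].
  set d := m1 x - m2 x; have d0 : 0 < d by rewrite subr_gt0.
  (* This makes $(n+1)d$ exceed $a(x)+1$. Then [k] is taken so that the drop term of the step
     estimate stays below 1, a contradiction. *)
  pose n := Num.bound ((a x + 1) / d).
  have a0 : 0 <= a x by exact: (s_ge0 0%N).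
  have hn : (a x + 1) / d < n.+1%:R.
    have h : 0 <= (a x + 1) / d by apply: divr_ge0; [exact: addr_ge0|exact: ltW].
    by apply: lt_trans (archi_boundP h) _; rewrite ltr_nat ltnSn.
  rewrite ltr_pdivrMr // in hn.
  have N0 : 0 < 2 * n.+1%:R ^+ 2 :> R by rewrite mulr_gt0 // exprn_gt0.
  have [k hk] : exists k, s k x - s k.+1 x < (2 * n.+1%:R ^+ 2)^-1.
    by apply: (@decr_small_step (fun k => s k x)) => //; rewrite invr_gt0.
  have [_ /(_ m1 m2 m10 m20 (sub k _ adm1) (sub k _ adm2) n x)] := FP (iter k F (exist _ a ga)).
  rewrite -/(s k) -[sval (F _)]/(s k.+1) -/d => h.
  have : 2 * n.+1%:R ^+ 2 * (s k x - s k.+1 x) < 1.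
    by rewrite mulrC -ltr_pdivlMr // mul1r.
  by have : s k x <= a x := s_mono 0%N k x isT; lra.
move=> m' m'0 adm_m' x; have mh0 := qform0 qmh.
by apply/le_anti; rewrite !uniq.
Qed.
End Forms.

(** * Elementary facts about real numbers *)

Section RealAnalysis.
Variable R : realType.

(** Since $f$ has period 1, the bound on $[0,1]$ holds everywhere, and $n|f(t)| = |f(nt)| \le B$ for
    all $n$ forces $f(t) = 0$. This takes the place of continuity in the real homogeneity of polar
    forms. *)
Lemma additive_bounded0 (f : R -> R) (B : R) : {morph f : s t / s + t} -> f 1 = 0 ->
  (forall t, 0 <= t <= 1 -> `|f t| <= B) -> forall t, f t = 0.
Proof.
move=> fD f1 fB.
have f0 : f 0 = 0 by have := fD 0 0; rewrite addr0; lra.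
have fn (n : nat) t : f (n%:R * t) = n%:R * f t.
  elim: n => [|n IH]; first by rewrite !mul0r.
  by rewrite mulrSr mulrDl mul1r fD IH; ring.
have fN t : f (- t) = - f t by have := fD t (- t); rewrite subrr f0; lra.
have fz (z : int) t : f (t - z%:~R) = f t.
  suff z0 : f z%:~R = 0 by rewrite fD fN z0 subr0.
  case: z => n; first by rewrite -[Posz n%N]/(n%:Z) -pmulrn -[n%:R]mulr1 fn f1 mulr0.
  by rewrite NegzE mulrNz fN -pmulrn -[n.+1%:R]mulr1 fn f1 mulr0 oppr0.
have fB' t : `|f t| <= B.
  rewrite -(fz (Num.floor t)); apply: fB.
  have /andP[l r] := floor_itv t.
  by rewrite subr_ge0 l /= lerBlDl (le_trans (ltW r)) // intrD.
move=> t; apply/eqP; rewrite -normr_le0 leNgt; apply/negP => ft.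
have B0 : 0 <= B by apply: le_trans (fB' 0); rewrite normr_ge0.
have := archi_boundP (divr_ge0 B0 (ltW ft)); set n := Num.bound _.
rewrite ltr_pdivrMr // => lt; have := fB' (n%:R * t).
by rewrite fn normrM normr_nat; lra.
Qed.

(** The parabola is tested at its vertex $-p/c$; when $c = 0$ and $p \ne 0$, at the point where it
    would take the value $-1$. *)
Lemma discr_le (a p c : R) : 0 <= c -> (forall t, 0 <= a + 2 * t * p + t ^+ 2 * c) ->
  p ^+ 2 <= a * c.
Proof.
rewrite le_eqVlt => /predU1P[<-|c0] h; last first.
  have := h (- p / c).
  have -> : a + 2 * (- p / c) * p + (- p / c) ^+ 2 * c = a - p ^+ 2 / c.
    by field; rewrite gt_eqF.
  by rewrite subr_ge0 ler_pdivrMr.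
rewrite mulr0; case: (eqVneq p 0) => [->|p0]; first by rewrite expr0n.
have := h (- (a + 1) / (2 * p)).
have -> : a + 2 * (- (a + 1) / (2 * p)) * p + (- (a + 1) / (2 * p)) ^+ 2 * 0 = -1.
  by field.
by lra.
Qed.

Lemma inv_nat_lt (e : R) : 0 < e -> exists n, forall m, (n <= m)%N -> m.+1%:R^-1 < e.
Proof.
move=> e0; have ie0 : 0 < e^-1 by rewrite invr_gt0.
exists (Num.bound e^-1) => m le; rewrite -[e]invrK ltf_pV2 ?posrE //.
apply: lt_trans (archi_boundP (ltW ie0)) _.
by rewrite ltr_nat ltnS.
Qed.

Lemma le0_small (x C : R) : (forall e, 0 < e -> x <= C * e) -> x <= 0.
Proof.
move=> h; rewrite leNgt; apply/negP => x0.
have C1 : 0 < `|C| + 1 by rewrite ltr_wpDl.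
have d0 : 0 < 2 * (`|C| + 1) by rewrite mulr_gt0.
have := h _ (divr_gt0 x0 d0); rewrite mulrA ler_pdivlMr // => le.
have : C * x <= `|C| * x by rewrite ler_pM2r // ler_norm.
by nra.
Qed.
End RealAnalysis.

(** * From bounded forms to operators: Jordan-von Neumann and Riesz *)

Section Representation.
Variables (R : realType) (H : lmodType R[i]) (sym : (H -> H) -> R -> Prop).

(** $|c|^2$ as an element of [R]; the norm on [R[i]] takes its values in [R[i]]. *)
Definition sqn (c : R[i]) : R := complex.Re c ^+ 2 + complex.Im c ^+ 2.

Hypothesis symD : forall g k, sym g k -> {morph g : x y / x + y}.
Hypothesis sym_gt0 : forall g k, sym g k -> 0 < k.
Hypothesis symV : forall g k, sym g k ->
  exists g' k', [/\ sym g' k', cancel g g', cancel g' g & k * k' = 1].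
Hypothesis sym_scale : forall c, c != 0 -> sym (fun x => c *: x) (sqn c).

Local Notation qform := (qform sym).

Lemma qform_scale q c x : qform q -> q (c *: x) = sqn c * q x.
Proof.
move=> qq; have [-> | c0] := eqVneq c 0; last by have [_ qG] := qq; exact: (qG _ _ (sym_scale c0)).

by rewrite scale0r (qform0 qq) /sqn /= !expr0n addr0 mul0r.
Qed.

Lemma qformN q x : qform q -> q (- x) = q x.
Proof. by move=> qq; rewrite -scaleN1r qform_scale // /sqn /=; ring. Qed.

(** For a squared Hilbert norm this is $\mathrm{Re}\langle x,y\rangle$; the imaginary part is the
    same expression at $(x, iy)$. *)
Definition polar (q : H -> R) x y := 4^-1 * (q (x + y) - q (x - y)).

Lemma polarC q x y : qform q -> polar q x y = polar q y x.
Proof. by move=> qq; rewrite /polar -[q (x - y)]qformN // opprB [x + y]addrC. Qed.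

Lemma polarNl q x y : qform q -> polar q (- x) y = - polar q x y.
Proof.
move=> qq; rewrite /polar -[q (- x - y)]qformN // -[q (- x + y)]qformN //.
by rewrite !opprD !opprK; ring.
Qed.

(** The parallelogram law at $(z+y, w)$ and $(z-y, w)$ gives [E]; on adding [E x x'] and [E x' x]
    the terms in $x - x'$ and $x' - x$ cancel. *)
Lemma polarDl q x x' y : qform q -> polar q (x + x') y = polar q x y + polar q x' y.
Proof.
move=> qq; have [qD _] := qq.
have E z w : polar q (z + w) y + polar q (z - w) y = 2 * polar q z y.
  have := qD (z + y) w; have := qD (z - y) w.
  by rewrite /polar ![z + _ + w]addrAC ![z + _ - w]addrAC; lra.
have := E x x'; have := E x' x; rewrite -[x' - x]opprB polarNl // [x' + x]addrC.
by lra.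
Qed.

Lemma polar_sym q g k x y : qform q -> sym g k -> polar q (g x) (g y) = k * polar q x y.
Proof.
move=> qq gk; have [_ qG] := qq.
by rewrite /polar -(symD gk) -(symB symD gk) !(qG _ _ gk); ring.
Qed.

Lemma polarDr q x y y' : qform q -> polar q x (y + y') = polar q x y + polar q x y'.
Proof. by move=> qq; rewrite ![polar q x _]polarC // polarDl. Qed.

Lemma polarNr q x y : qform q -> polar q x (- y) = - polar q x y.
Proof. by move=> qq; rewrite ![polar q x _]polarC // polarNl. Qed.

Lemma polarBl q x x' y : qform q -> polar q (x - x') y = polar q x y - polar q x' y.
Proof. by move=> qq; rewrite polarDl // polarNl. Qed.

Lemma polarBr q x y y' : qform q -> polar q x (y - y') = polar q x y - polar q x y'.
Proof. by move=> qq; rewrite ![polar q x _]polarC // polarBl. Qed.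

Lemma polarxx q x : qform q -> polar q x x = q x.
Proof.
move=> qq; rewrite /polar subrr (qform0 qq) -mulr2n -scaler_nat qform_scale //.
by rewrite /sqn /=; field.
Qed.

Lemma polar0l q y : qform q -> polar q 0 y = 0.
Proof. by move=> qq; have := polarDl 0 0 y qq; rewrite addr0; lra. Qed.

Lemma qformDe q x y : qform q -> q (x + y) = q x + 2 * polar q x y + q y.
Proof.
move=> qq; rewrite -(polarxx (x + y) qq) polarDl // !polarDr // !polarxx //.
by rewrite (polarC y x qq); ring.
Qed.

(** The defect from homogeneity is additive and vanishes at 1. Positivity of [q] gives
    $|2\,\mathrm{polar}(z,y)| \le q(z) + q(y)$, which bounds the defect on $[0,1]$. *)
Lemma polar_real q t x y : qform q -> (forall x, 0 <= q x) ->
  polar q (t%:C *: x) y = t * polar q x y.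
Proof.
move=> qq q0.
pose f s := polar q (s%:C *: x) y - s * polar q x y.
suff : f t = 0 by rewrite /f; lra.
apply: (@additive_bounded0 _ f (q x + q y)).
- by move=> u v; rewrite /f rmorphD /= scalerDl polarDl //; ring.
- by rewrite /f scale1r mul1r subrr.
have le z : `|2 * polar q z y| <= q z + q y.
  rewrite ler_norml; have := q0 (z + y); have := q0 (z - y).
  by rewrite !(qformDe _ _ qq) (qformN _ qq) // polarNr //; lra.
move=> s /andP[s0 s1]; rewrite /f.
have := le (s%:C *: x); have := le x; rewrite (qform_scale _ _ qq) /sqn /= expr0n addr0.
rewrite !ler_norml => /andP[l1 l2] /andP[l3 l4].
have qx := q0 x; have qy := q0 y; have s2 : s ^+ 2 * q x <= q x by rewrite ler_piMl // expr_le1.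
by apply/andP; split; nra.
Qed.

(** Write $\bar c = |c|^2c^{-1}$ and $y = c\,(c^{-1}y)$; invariance under [c] takes out the factor
    $|c|^2$. *)
Lemma polar_adj q c x y : qform q -> (forall x, 0 <= q x) ->
  polar q (c *: x) y = polar q x (conjc c *: y).
Proof.
move=> qq q0; have [-> | c0] := eqVneq c 0.
  by rewrite conjc0 !scale0r polar0l // polarC // polar0l.
have -> : conjc c *: y = (sqn c)%:C *: (c^-1 *: y).
  rewrite scalerA; congr (_ *: _); rewrite [c^-1]invc_norm mulrA.
  by rewrite /sqn add_Re2_Im2 mulfV ?mul1r // expf_neq0 // normr_eq0.
rewrite (polarC x) // polar_real // [polar q _ x]polarC // -(polar_sym _ _ qq (sym_scale c0)).
by rewrite scalerA mulfV // scale1r.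
Qed.

(** Moving $i$ to the other argument changes the sign, while symmetry does not. This later makes
    $\langle Tx, x\rangle$ real for the operator of a form. *)
Lemma polar_i q x : qform q -> (forall x, 0 <= q x) -> polar q x ('i%C *: x) = 0.
Proof.
move=> qq q0; have := polar_adj 'i%C x x qq q0.
have -> : conjc 'i%C = - 'i%C :> R[i] by rewrite /= ; congr Complex; rewrite oppr0.
by rewrite scaleNr polarNr // [polar q ('i *: x) x]polarC //; lra.
Qed.

Lemma polar_CS q x y : qform q -> (forall x, 0 <= q x) -> polar q x y ^+ 2 <= q x * q y.
Proof.
move=> qq q0; apply: discr_le => // t.
have := q0 (x + t%:C *: y); rewrite (qformDe _ _ qq) (qform_scale _ _ qq) // /sqn /= expr0n addr0.
by rewrite polarC // polar_real // (polarC y) //; lra.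
Qed.

Variable N : H -> R.
Hypothesis qN : qform N.
Hypothesis N_ge0 : forall x, 0 <= N x.
Hypothesis N_eq0 : forall x, N x = 0 -> x = 0.
Hypothesis N_complete : forall u : nat -> H,
  (forall e, 0 < e -> exists p, forall m n, (p <= m)%N -> (p <= n)%N -> N (u m - u n) < e) ->
  exists l, forall e, 0 < e -> exists p, forall n, (p <= n)%N -> N (u n - l) < e.

Lemma polar_inj u v : (forall y, polar N y u = polar N y v) -> u = v.
Proof.
move=> h; apply/eqP; rewrite -subr_eq0; apply/eqP/N_eq0.
by rewrite -polarxx // polarBr // h subrr.
Qed.

(** The representing vector is the minimiser of $J = N - 2f$: almost minimising sequences are Cauchy
    by the parallelogram law. *)
Lemma riesz (f : H -> R) (C : R) : {morph f : x y / x + y} ->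
  (forall t x, f (t%:C *: x) = t * f x) -> 0 <= C ->
  (forall x, f x ^+ 2 <= C * N x) -> exists w, forall x, f x = polar N x w.
Proof.
move=> fD fZ C0 fC.
pose J x := N x - 2 * f x.
(* From $4f^2 \le 4CN \le (N + C)^2$. *)
have J_ge x : - C <= J x.
  have := fC x; have := N_ge0 x; rewrite /J; move: (N x) (f x) => n y n0 le.
  suff : 2 * y <= n + C by lra.
  have nC : 0 <= n + C by rewrite addr_ge0.
  have [y0|y0] := ltP y 0; first by apply: le_trans nC; lra.
  rewrite -(@ler_pXn2r _ 2) ?nnegrE ?mulr_ge0 //.
  by have := sqr_ge0 (n - C); nra.
pose I := inf (range J).
have I_lb x : I <= J x.
  by apply: ge_inf; [exists (- C) => _ [y _ <-]|exists x].
have I_approx n : exists x, J x < I + n.+1%:R^-1.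
  have [||_ [x _ <-] lt] := @inf_adherent _ (range J) n.+1%:R^-1.
  - by rewrite invr_gt0.
  - by split; [exists (J 0), 0|exists (- C) => _ [y _ <-]].
  by exists x.
have [u uP] := choice I_approx.
(* The midpoint [h] of [u m] and [u n] satisfies $J(h) \ge I$, and $N(u_m - u_n) = 2J(u_m) + 2J(u_n)
   - 4J(h)$. *)
have uu m n : N (u m - u n) <= 2 * (m.+1%:R^-1 + n.+1%:R^-1).
  pose h := (2^-1)%:C *: (u m + u n).
  have hE : u m + u n = 2%:C *: h.
    by rewrite /h scalerA -rmorphM /= mulfV ?pnatr_eq0 // scale1r.
  have := I_lb h; have := uP m; have := uP n; have [/(_ (u m) (u n)) + _] := qN.
  have fE : f (u m) + f (u n) = 2 * f h by rewrite -fD hE fZ.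
  have NE : N (u m + u n) = 4 * N h by rewrite hE qform_scale // /sqn /=; ring.
  move=> h1 h2 h3 h4; rewrite NE in h1; move: h2 h3 h4; rewrite /J.
  by move: n.+1%:R^-1 m.+1%:R^-1 => r r'; lra.
have [e e0|w wP] := @N_complete u.
  have [p hp] := inv_nat_lt (divr_gt0 e0 (ltr0Sn R 3)).
  exists p => m n /hp hm /hp hn; apply: le_lt_trans (uu m n) _.
  by move: n.+1%:R^-1 m.+1%:R^-1 hm hn => r r'; rewrite !ltr_pdivlMr //; lra.
exists w => v.
(* Perturbing [u n] by $tv$ cannot lower [J] by more than $1/(n+1)$; the discriminant in $t$ gives
   the bound. *)
have near_u n : (polar N (u n) v - f v) ^+ 2 <= n.+1%:R^-1 * N v.
  apply: discr_le => // t.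
  have := I_lb (u n + t%:C *: v); have := uP n.
  rewrite /J fD fZ (qformDe _ _ qN) (qform_scale _ _ qN) // /sqn /= expr0n addr0.
  rewrite (polarC (u n)) // polar_real // (polarC v) //.
  by move: n.+1%:R^-1 => r; lra.
apply/eqP; rewrite -subr_eq0 -sqrf_eq0 eq_le sqr_ge0 andbT.
apply: (@le0_small _ _ (4 * N v)) => e e0.
have [p hp] := inv_nat_lt e0; have [p' hp'] := wP _ e0.
pose n := maxn p p'.
have h1 := hp n (leq_maxl _ _); have h2 := hp' n (leq_maxr _ _).
have h3 := polar_CS (u n - w) v qN N_ge0; rewrite polarBl // in h3.
have h4 := near_u n; have Nv := N_ge0 v.
have h5 : N (u n - w) * N v <= e * N v by rewrite ler_wpM2r // ltW.
have h6 : n.+1%:R^-1 * N v <= e * N v by rewrite ler_wpM2r // ltW.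
rewrite (polarC v) //; move: (le_trans h3 h5) (le_trans h4 h6).
(* This square is $(p - q)^2$ for the differences $p = f(v) - \langle u_n, v\rangle$ and $q =
   \langle u_n - w, v\rangle$, whence $(p+q)^2 \le 2p^2 + 2q^2$. *)
clear -Nv; by have := sqr_ge0 (f v - 2 * polar N (u n) v + polar N w v); nra.
Qed.

(** Riesz applies to $y \mapsto$ [polar q y x] with constant $c\,q(x)$. Symmetries scale [q] and [N]
    by the same factor, so uniqueness of the representing vector makes [T] commute with them. The
    norm bound is Cauchy-Schwarz at $(Tx, x)$. *)
Lemma form_operator q (c : R) : qform q -> (forall x, 0 <= q x) -> 0 <= c ->
  (forall x, q x <= c * N x) -> exists T : H -> H,
  [/\ {morph T : x y / x + y},
      forall g k, sym g k -> forall x, T (g x) = g (T x),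
      forall x y, polar q y x = polar N y (T x)
    & forall x, N (T x) <= c ^+ 2 * N x].
Proof.
move=> qq q0 c0 qc.
have [x|T TP] := @choice _ _ (fun x w => forall y, polar q y x = polar N y w).
  apply: (@riesz (fun y => polar q y x) (c * q x)).
  - by move=> y y'; rewrite polarDl.
  - by move=> t y; rewrite polar_real.
  - by rewrite mulr_ge0.
  move=> y; apply: le_trans (polar_CS y x qq q0) _.
  by rewrite mulrAC ler_wpM2r.
exists T; split=> //.
- by move=> x y; apply: polar_inj => z; rewrite -TP polarDr // !TP -polarDr.
- move=> g k gk x; apply: polar_inj => y.
  have [g' [k' [gk' _ g'K _]]] := symV gk.
  by rewrite -TP -[y]g'K !(polar_sym _ _ _ gk) // TP.
move=> x; have := polar_CS (T x) x qq q0; rewrite TP polarxx // => le.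
have [->|NT] := eqVneq (N (T x)) 0; first by rewrite mulr_ge0 // sqr_ge0.
have NT0 : 0 < N (T x) by rewrite lt_def NT N_ge0.
rewrite -(ler_pM2l NT0) -expr2; apply: le_trans le _.
apply: (@le_trans _ _ (c * N (T x) * (c * N x))); first by rewrite ler_pM.
by rewrite le_eqVlt; apply/orP; left; apply/eqP; ring.
Qed.
End Representation.

(** * Limits of real sequences *)

Section Limits.
Variable R : realType.

Definition tends (s : nat -> R) (l : R) :=
  forall e, 0 < e -> exists p, forall n, (p <= n)%N -> `|s n - l| < e.

Lemma tendsD s t l l' : tends s l -> tends t l' -> tends (fun n => s n + t n) (l + l').
Proof.
move=> sl tl e e0; have e2 : 0 < e / 2 by rewrite divr_gt0.
have [p hp] := sl _ e2; have [p' hp'] := tl _ e2.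
exists (maxn p p') => n; rewrite geq_max => /andP[/hp h /hp' h'].
rewrite opprD addrACA; apply: le_lt_trans (ler_normD _ _) _.
by rewrite [e]splitr ltrD.
Qed.

Lemma tendsZ c s l : tends s l -> tends (fun n => c * s n) (c * l).
Proof.
move=> sl e e0; have c0 : 0 < `|c| + 1 by rewrite ltr_wpDl.
have [p hp] := sl _ (divr_gt0 e0 c0); exists p => n /hp.
rewrite -mulrBr normrM ltr_pdivlMr // mulrC; apply: le_lt_trans.
by rewrite ler_wpM2r // lerDl.
Qed.

Lemma tends_unique s l l' : tends s l -> tends s l' -> l = l'.
Proof.
move=> sl sl'; apply/eqP; rewrite -subr_eq0 -normr_le0.
apply: (@le0_small _ _ 2) => e e0.
have [p hp] := sl _ e0; have [p' hp'] := sl' _ e0.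
have := hp _ (leq_maxl p p'); have := hp' _ (leq_maxr p p').
rewrite distrC => h h'; have -> : l - l' = (l - s (maxn p p')) + (s (maxn p p') - l').
  by rewrite addrA subrK.
by rewrite distrC in h; rewrite distrC in h'; apply: le_trans (ler_normD _ _) _; lra.
Qed.

Lemma tends_sum0 (F : nat -> nat -> R) n : (forall i, tends (F i) 0) ->
  tends (fun m => \sum_(i < n) F i m) 0.
Proof.
move=> F0; elim: n => [|n IH].
  by move=> e e0; exists 0%N => m _; rewrite big_ord0 subrr normr0.
have -> : (fun m => \sum_(i < n.+1) F i m) = (fun m => \sum_(i < n) F i m + F n m).
  by apply/funext => m; rewrite big_ord_recr.
by have := tendsD IH (F0 n); rewrite addr0.
Qed.
End Limits.

(** * Sums over the symmetric windows $[-n, n]$ *)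

Section PartialSums.
Variable R : realType.
Implicit Type f : int -> R.

Lemma psumRD f g n : psumR (fun j => f j + g j) n = psumR f n + psumR g n.
Proof. exact: big_split. Qed.

Lemma psumRZ c f n : psumR (fun j => c * f j) n = c * psumR f n.
Proof. by rewrite /psumR mulr_sumr. Qed.

Lemma psumR_le f g n : (forall j, f j <= g j) -> psumR f n <= psumR g n.
Proof. by move=> fg; apply: ler_sum. Qed.

(** The shifted window $[-n-1, n-1]$ is not symmetric, but it lies in the next larger one, which
    suffices for comparing suprema. *)
Lemma psumR_shift_le f n : (forall j, 0 <= f j) ->
  psumR (fun j => f (j - 1)) n <= psumR f n.+1.
Proof.
move=> f0; rewrite [leRHS]/psumR doubleS 2!big_ord_recr /= -addrA /psumR.
apply: ler_wpDr; first exact: addr_ge0.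
by apply: ler_sum => i _; rewrite le_eqVlt; apply/orP; left; apply/eqP; congr f; lia.
Qed.

Lemma psumR_unshift_le f n : (forall j, 0 <= f j) ->
  psumR (fun j => f (j + 1)) n <= psumR f n.+1.
Proof.
move=> f0; rewrite [leRHS]/psumR doubleS 2!big_ord_recl /= addrA /psumR.
apply: ler_wpDl; first exact: addr_ge0.
apply: ler_sum => i _; rewrite /bump !leq0n le_eqVlt; apply/orP; left; apply/eqP; congr f; lia.
Qed.

Lemma psumR_mono f n p : (forall j, 0 <= f j) -> (n <= p)%N -> psumR f n <= psumR f p.
Proof.
move=> f0 /subnK <-; elim: (p - n)%N => // d /le_trans; apply; rewrite addSn.
move: (d + n)%N => q; rewrite [leRHS]/psumR doubleS big_ord_recl big_ord_recr /= /psumR.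
apply: ler_wpDl => //; apply: ler_wpDr => //.
by apply: ler_sum => i _; rewrite /bump !leq0n le_eqVlt; apply/orP; left; apply/eqP; congr f; lia.
Qed.

Lemma psumR_term f j : (forall j, 0 <= f j) -> f j <= psumR f `|j|%N.
Proof.
move=> f0; have lt : (`|(j + `|j|%N%:Z)%R| < `|j|.*2.+1)%N by lia.
rewrite /psumR (bigD1 (Ordinal lt)) //=; apply: ler_wpDr; first exact: sumr_ge0.
by rewrite le_eqVlt; apply/orP; left; apply/eqP; congr f; lia.
Qed.

Lemma psumC_Complex (f : int -> R[i]) n :
  psumC f n = Complex (psumR (fun j => complex.Re (f j)) n) (psumR (fun j => complex.Im (f j)) n).
Proof.
rewrite /psumC /psumR; elim/big_ind3: _ => //= [x r s y r' s' -> -> //|i _].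
by case: (f _).
Qed.

End PartialSums.

(** * The Hilbert space $L^2$, its symmetries and its inner product *)

Section L2.
Variables (R : realType) (K : lmodType R[i]) (ip : K -> K -> R[i]).
Hypothesis HK : is_hilbert ip.

Lemma ipDl x y z : ip (x + y) z = ip x z + ip y z.
Proof. by have [[]] := HK. Qed.

Lemma ipZl c x y : ip (c *: x) y = c * ip x y.
Proof. by have [[]] := HK. Qed.

Lemma ipC x y : ip y x = conjc (ip x y).
Proof. by have [[]] := HK. Qed.

Lemma ipDr x y z : ip z (x + y) = ip z x + ip z y.
Proof. by rewrite ipC ipDl rmorphD /= -!ipC. Qed.

Lemma ipZr c x y : ip x (c *: y) = conjc c * ip x y.
Proof. by rewrite ipC ipZl rmorphM /= -!ipC. Qed.

Lemma nrm2_ge0 x : 0 <= nrm2 ip x.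
Proof. by have [[_ _ _ /(_ x) + _] _] := HK; rewrite lecE /= => /andP[]. Qed.

Lemma nrm2Z c x : nrm2 ip (c *: x) = sqn c * nrm2 ip x.
Proof.
rewrite /nrm2 ipZl ipZr; have [[_ _ _ /(_ x) + _] _] := HK.
by rewrite /sqn; case: (ip x x) c => r s [c d] /ger0_Im /= ->; ring.
Qed.

Lemma nrm2_eq0 x : nrm2 ip x = 0 -> x = 0.
Proof.
have [[_ _ _ /(_ x) x0 eq0] _] := HK => xx; apply: eq0.
by move: x0 xx (ger0_Im x0); rewrite /nrm2; case: (ip x x) => r s _ /= -> ->.
Qed.

Lemma nrm2D x y : nrm2 ip (x + y) = nrm2 ip x + 2 * complex.Re (ip x y) + nrm2 ip y.
Proof.
rewrite /nrm2 ipDl !ipDr (ipC x y).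
by case: (ip x x) (ip y y) (ip x y) => [? ?] [? ?] [? ?] /=; ring.
Qed.

Lemma nrm2B x y : nrm2 ip (x - y) = nrm2 ip x - 2 * complex.Re (ip x y) + nrm2 ip y.
Proof.
rewrite nrm2D -scaleN1r nrm2Z ipZr.
by case: (ip x y) => [? ?]; rewrite /sqn /=; ring.
Qed.

Lemma Re_ip x y : complex.Re (ip x y) = 4^-1 * (nrm2 ip (x + y) - nrm2 ip (x - y)).
Proof. by rewrite nrm2D nrm2B; field. Qed.

Lemma Im_ip x y : complex.Im (ip x y) = complex.Re (ip x ('i%C *: y)).
Proof. by rewrite ipZr; case: (ip x y) => [? ?] /=; ring. Qed.

Definition L2 : {pred (int -> K)} := [pred x | `[< inL2 ip x >]].

Lemma L2P x : reflect (inL2 ip x) (x \in L2).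
Proof. exact: asboolP. Qed.

Lemma inL2_submod : submod_closed L2.
Proof.
split.
  apply/L2P; exists 0 => n.
  by rewrite /psumR big1 // => i _; rewrite -[0 _]/(0 : K) -(scale0r 0) nrm2Z // /sqn /= !expr0n addr0 mul0r.
move=> c u v /L2P[S hS] /L2P[S' hS']; apply/L2P.
exists (2 * sqn c * S + 2 * S') => n.
have c0 : 0 <= sqn c by rewrite addr_ge0 // sqr_ge0.
apply: le_trans (_ : psumR (fun j => 2 * sqn c * nrm2 ip (u j) + 2 * nrm2 ip (v j)) n <= _).
  apply: psumR_le => j.
  have := nrm2_ge0 (c *: u j - v j); rewrite nrm2B nrm2Z => h.
  by rewrite -[(c *: u + v) j]/(c *: u j + v j) nrm2D nrm2Z; lra.
rewrite psumRD !psumRZ lerD // ler_wpM2l // ?mulr_ge0 //.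
Qed.

HB.instance Definition _ := GRing.isSubmodClosed.Build R[i] (int -> K) L2 inL2_submod.

(** Bundling the square-summable sequences makes $L^2$ itself a module, to which the abstract
    results on forms apply. *)
Record l2 := L2Seq { l2_val :> int -> K; l2_valP : l2_val \in L2 }.

HB.instance Definition _ := [isSub for l2_val].
HB.instance Definition _ := [Choice of l2 by <:].
HB.instance Definition _ := [SubChoice_isSubLmodule of l2 by <:].

Lemma inL2_l2 (x : l2) : inL2 ip x.
Proof. exact/L2P/l2_valP. Qed.

Lemma l2_of_inL2 x : inL2 ip x -> exists X : l2, x = X.
Proof. by move=> /L2P xL; exists (L2Seq xL). Qed.

Lemma l2D (x y : l2) j : (x + y) j = x j + y j. Proof. by []. Qed.
Lemma l2B (x y : l2) j : (x - y) j = x j - y j. Proof. by []. Qed.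
Lemma l2Z c (x : l2) j : (c *: x) j = c *: x j. Proof. by []. Qed.

Definition sqnorm (x : l2) : R := sup (range (psumR (fun j => nrm2 ip (x j)))).

Lemma psumR_le_sqnorm (x : l2) n : psumR (fun j => nrm2 ip (x j)) n <= sqnorm x.
Proof.
have [S hS] := inL2_l2 x; apply: ub_le_sup; last by exists n.
by exists S => _ [p _ <-].
Qed.

Lemma sqnorm_le (x : l2) S : (forall n, psumR (fun j => nrm2 ip (x j)) n <= S) -> sqnorm x <= S.
Proof. by move=> h; apply: ge_sup => [|_ [p _ <-] //]; exists (psumR (fun j => nrm2 ip (x j)) 0), 0%N. Qed.

Lemma sqnorm_ge_term (x : l2) j : nrm2 ip (x j) <= sqnorm x.
Proof.
apply: le_trans (psumR_le_sqnorm x `|j|%N).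
by apply: (@psumR_term _ (fun j => nrm2 ip (x j))) => k; exact: nrm2_ge0.
Qed.

Lemma sqnorm_ge0 x : 0 <= sqnorm x.
Proof. by apply: le_trans (sqnorm_ge_term x 0); exact: nrm2_ge0. Qed.

Lemma sqnorm_eq0 x : sqnorm x = 0 -> x = 0.
Proof.
move=> x0; apply/val_inj/funext => j; apply: nrm2_eq0; apply/le_anti.
by rewrite nrm2_ge0 -x0 sqnorm_ge_term.
Qed.

Lemma tends_sqnorm (x : l2) : tends (psumR (fun j => nrm2 ip (x j))) (sqnorm x).
Proof.
move=> e e0; have [|_ [p _ <-] lt] := @sup_adherent _ (range (psumR (fun j => nrm2 ip (x j)))) e e0.
  split; first by exists (psumR (fun j => nrm2 ip (x j)) 0), 0%N.
  by exists (sqnorm x) => _ [p _ <-]; exact: psumR_le_sqnorm.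
exists p => n pn; rewrite ler0_norm ?subr_le0 ?psumR_le_sqnorm // opprB ltrBlDl -ltrBlDr.
apply: lt_le_trans lt _; apply: psumR_mono => // j; exact: nrm2_ge0.
Qed.

Lemma shift_inL2 (x : l2) : shift x \in L2.
Proof.
apply/L2P; exists (sqnorm x) => n; apply: le_trans (psumR_le_sqnorm x n.+1).
by apply: (@psumR_shift_le _ (fun j => nrm2 ip (x j))) => j; exact: nrm2_ge0.
Qed.

Lemma unshift_inL2 (x : l2) : (fun j => x (j + 1)) \in L2.
Proof.
apply/L2P; exists (sqnorm x) => n; apply: le_trans (psumR_le_sqnorm x n.+1).
by apply: (@psumR_unshift_le _ (fun j => nrm2 ip (x j))) => j; exact: nrm2_ge0.
Qed.

Definition shiftH (x : l2) : l2 := L2Seq (shift_inL2 x).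
Definition unshiftH (x : l2) : l2 := L2Seq (unshift_inL2 x).

Lemma shiftHK : cancel shiftH unshiftH.
Proof. by move=> x; apply/val_inj/funext => j /=; rewrite /shift addrK. Qed.

Lemma unshiftHK : cancel unshiftH shiftH.
Proof. by move=> x; apply/val_inj/funext => j /=; rewrite /shift subrK. Qed.

Lemma shiftHD : {morph shiftH : x y / x + y}.
Proof. by move=> x y; apply/val_inj/funext. Qed.

Lemma unshiftHD : {morph unshiftH : x y / x + y}.
Proof. by move=> x y; apply/val_inj/funext. Qed.

(** The inverse shift is listed so that the family is closed under inverses; the scalars already
    contain the positive integers. *)
Inductive l2sym : (l2 -> l2) -> R -> Prop :=
| l2sym_scale c : c != 0 -> l2sym (fun x => c *: x) (sqn c)
| l2sym_shift : l2sym shiftH 1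
| l2sym_unshift : l2sym unshiftH 1.

Lemma l2symD g k : l2sym g k -> {morph g : x y / x + y}.
Proof. by case=> [c _ x y||]; [exact: scalerDr|exact: shiftHD|exact: unshiftHD]. Qed.

Lemma sqnM c d : sqn (c * d) = sqn c * sqn d :> R.
Proof. by case: c d => [? ?] [? ?]; rewrite /sqn /=; ring. Qed.

Lemma l2sym_gt0 g k : l2sym g k -> 0 < k.
Proof.
case=> // c c0; rewrite lt_def addr_ge0 ?sqr_ge0 // andbT.
apply: contra c0; rewrite /sqn paddr_eq0 ?sqr_ge0 // !sqrf_eq0.
by case: c => [r s] /=; rewrite eq_complex.
Qed.

Lemma l2symV g k : l2sym g k ->
  exists g' k', [/\ l2sym g' k', cancel g g', cancel g' g & k * k' = 1].
Proof.
case=> [c c0||].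
- exists (fun x => c^-1 *: x), (sqn c^-1); split=> [|x|x|].
  + by apply: l2sym_scale; rewrite invr_eq0.
  + by rewrite scalerA mulVf // scale1r.
  + by rewrite scalerA mulfV // scale1r.
  + by rewrite -sqnM mulfV // /sqn /= expr1n expr0n addr0.
- exists unshiftH, 1; split; [exact: l2sym_unshift|exact: shiftHK|exact: unshiftHK|exact: mulr1].
- exists shiftH, 1; split; [exact: l2sym_shift|exact: unshiftHK|exact: shiftHK|exact: mulr1].
Qed.

Lemma l2sym_muln n : l2sym (fun x => x *+ n.+1) (n.+1%:R ^+ 2).
Proof.
have := @l2sym_scale n.+1%:R; rewrite pnatr_eq0 => /(_ isT).
rewrite (_ : (fun x => _) = (fun x => x *+ n.+1)); last by apply/funext => x; rewrite scaler_nat.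
by rewrite -(rmorph_nat (real_complex R)) /sqn /= expr0n addr0.
Qed.

Local Notation qform := (qform l2sym).
Local Notation bform := (bform l2sym).

(** The algebraic identities pass from partial sums to limits. For the shifts only inequalities
    pass, and using both directions turns them into equalities. *)
Lemma qform_sqnorm : qform sqnorm.
Proof.
split=> [x y|g k gk x].
  apply: (@tends_unique _ (fun n => psumR (fun j => nrm2 ip ((x + y) j)) n + psumR (fun j => nrm2 ip ((x - y) j)) n)).
    by apply: tendsD; exact: tends_sqnorm.
  have -> : (fun n => psumR (fun j => nrm2 ip ((x + y) j)) n + psumR (fun j => nrm2 ip ((x - y) j)) n)
    = (fun n => 2 * (psumR (fun j => nrm2 ip (x j)) n + psumR (fun j => nrm2 ip (y j)) n)).
    apply/funext => n; rewrite -!psumRD -psumRZ; congr psumR; apply/funext => j.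
    by rewrite l2D l2B nrm2D nrm2B; ring.
  by apply/tendsZ/tendsD; exact: tends_sqnorm.
have shift_le z : sqnorm (shiftH z) <= sqnorm z.
  apply: sqnorm_le => n; apply: le_trans (psumR_le_sqnorm z n.+1).
  by apply: (@psumR_shift_le _ (fun j => nrm2 ip (z j))) => j; exact: nrm2_ge0.
have unshift_le z : sqnorm (unshiftH z) <= sqnorm z.
  apply: sqnorm_le => n; apply: le_trans (psumR_le_sqnorm z n.+1).
  by apply: (@psumR_unshift_le _ (fun j => nrm2 ip (z j))) => j; exact: nrm2_ge0.
case: gk => [c c0||].
- apply: (@tends_unique _ (psumR (fun j => nrm2 ip ((c *: x) j)))); first exact: tends_sqnorm.
  have -> : psumR (fun j => nrm2 ip ((c *: x) j)) = (fun n => sqn c * psumR (fun j => nrm2 ip (x j)) n).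
    by apply/funext => n; rewrite -psumRZ; congr psumR; apply/funext => j; rewrite l2Z nrm2Z.
  exact/tendsZ/tends_sqnorm.
- by rewrite mul1r; apply/le_anti; rewrite shift_le -{1}[x]shiftHK unshift_le.
- by rewrite mul1r; apply/le_anti; rewrite unshift_le -{1}[x]unshiftHK shift_le.
Qed.

(** The limit is taken coordinatewise. On a fixed window $u_n - l$ is compared with $u_n - u_m$ for
    [m] so large that the rest is small there; the bound does not depend on the window. *)
Lemma sqnorm_complete (u : nat -> l2) :
  (forall e, 0 < e -> exists p, forall m n, (p <= m)%N -> (p <= n)%N -> sqnorm (u m - u n) < e) ->
  exists l, forall e, 0 < e -> exists p, forall n, (p <= n)%N -> sqnorm (u n - l) < e.
Proof.
move=> cauchy.
have [j|l lP] := @choice _ _ (fun j z => forall e, 0 < e ->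
    exists p, forall n, (p <= n)%N -> nrm2 ip (u n j - z) < e).
  have [|z zP] := (let: conj _ h := HK in h) (fun n => u n j).
    move=> e e0; have [p hp] := cauchy _ (exprn_gt0 2 e0).
    exists p => m n pm pn; apply: le_lt_trans (hp m n pm pn).
    by rewrite -l2B sqnorm_ge_term.
  (* [is_complete] measures squared distances against [e ^+ 2], hence the square root. *)
  exists z => e e0; have [|p hp] := zP (Num.sqrt e); first by rewrite sqrtr_gt0.
  by exists p => n /hp; rewrite sqr_sqrtr // ltW.
have bound e : 0 < e -> exists p, forall n, (p <= n)%N ->
    forall r, psumR (fun j => nrm2 ip (u n j - l j)) r <= 4 * e.
  move=> e0; have [p hp] := cauchy _ e0; exists p => n pn r.
  have [|q hq] := @tends_sum0 _ (fun i m => nrm2 ip (u m (i%:Z - r%:Z) - l (i%:Z - r%:Z))) r.*2.+1 _ e e0.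
    move=> i d d0; have [q hq] := lP (i%:Z - r%:Z) _ d0.
    by exists q => m /hq; rewrite subr0 ger0_norm ?nrm2_ge0.
  pose m := maxn p q.
  have h1 := hp n m pn (leq_maxl _ _).
  have h2 : psumR (fun j => nrm2 ip (u m j - l j)) r < e.
    by apply: le_lt_trans (hq m (leq_maxr _ _)); rewrite subr0 ler_norm.
  have h3 := psumR_le_sqnorm (u n - u m) r.
  apply: le_trans (_ : psumR (fun j => 2 * nrm2 ip ((u n - u m) j) + 2 * nrm2 ip (u m j - l j)) r <= _).
    apply: psumR_le => j.
    have -> : u n j - l j = (u n - u m) j + (u m j - l j) by rewrite l2B addrA subrK.
    have := nrm2_ge0 ((u n - u m) j - (u m j - l j)).
    by rewrite (nrm2B ((u n - u m) j)) (nrm2D ((u n - u m) j)); lra.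
  by rewrite psumRD !psumRZ; lra.
have lL : l \in L2.
  have [p hp] := bound 1 ltr01.
  have dL : (u p : int -> K) - l \in L2 by apply/L2P; exists (4 * 1) => r; exact: hp.
  have -> : l = (u p : int -> K) - ((u p : int -> K) - l) by rewrite subKr.
  by apply: rpredB => //; exact: l2_valP.
exists (L2Seq lL) => e e0; have [p hp] := bound (e / 8) (divr_gt0 e0 (ltr0Sn _ 7)).
by exists p => n pn; have := @sqnorm_le (u n - L2Seq lL) _ (hp n pn); lra.
Qed.
Local Notation dot := (polar sqnorm).

Lemma tends_dot (x y : l2) : tends (psumR (fun j => complex.Re (ip (x j) (y j)))) (dot x y).
Proof.
have -> : psumR (fun j => complex.Re (ip (x j) (y j))) = (fun n =>
    4^-1 * (psumR (fun j => nrm2 ip ((x + y) j)) n + -1 * psumR (fun j => nrm2 ip ((x - y) j)) n)).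
  apply/funext => n; rewrite -!psumRZ -psumRD -psumRZ; congr psumR; apply/funext => j.
  by rewrite Re_ip mulN1r.
rewrite /polar -[- sqnorm (x - y)]mulN1r.
by apply/tendsZ/tendsD; [|apply: tendsZ]; exact: tends_sqnorm.
Qed.

(** The inner product is conjugate-linear in its second argument, so $\mathrm{Im}\langle x,y\rangle
    = \mathrm{Re}\langle x, iy\rangle$. *)
Definition cdot (x y : l2) : R[i] := Complex (dot x y) (dot x ('i%C *: y)).

Lemma ip2_cdot (x y : l2) : ip2 ip x y (cdot x y).
Proof.
move=> e e0; have [r -> r0] : exists2 r : R, e = r%:C & 0 < r.
  by case: e e0 => a b; rewrite ltcE /= => /andP[/eqP -> a0]; exists a.
have r2 : 0 < r / 2 by rewrite divr_gt0.
have [p hp] := tends_dot x y r2; have [q hq] := tends_dot x ('i%C *: y) r2.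
exists (maxn p q) => n; rewrite geq_max => /andP[/hp h1 /hq h2].
have -> : psumC (fun j => ip (x j) (y j)) n = Complex (psumR (fun j => complex.Re (ip (x j) (y j))) n)
    (psumR (fun j => complex.Re (ip (x j) (('i%C *: y) j))) n).
  by rewrite psumC_Complex; congr Complex; congr psumR; apply/funext => j; rewrite Im_ip.
rewrite /cdot; move: (psumR _ n) (psumR _ n) h1 h2 => t s h1 h2.
have -> : Complex s t - Complex (dot x y) (dot x ('i%C *: y))
    = (s - dot x y)%:C + 'i%C * (t - dot x ('i%C *: y))%:C.
  by rewrite [LHS]complexE.
apply: le_lt_trans (ler_normD _ _) _.
rewrite normrM (_ : `|'i%C| = 1 :> R[i]) ?mul1r; last first.
  by rewrite normc_def /= expr0n expr1n add0r sqrtr1.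
have nE u : `|u%:C| = `|u|%:C :> R[i] by rewrite normc_def /= expr0n addr0 sqrtr_sqr.
by rewrite !nE -rmorphD ltcR /= [r]splitr ltrD.
Qed.

Lemma ip2P (x y : l2) s : ip2 ip x y s <-> s = cdot x y.
Proof.
split=> [h|->]; last exact: ip2_cdot.
apply/eqP; rewrite -subr_eq0 -normr_eq0 eq_le normr_ge0 andbT.
have nE : `|s - cdot x y| = (complex.Re `|s - cdot x y|)%:C by rewrite normc_def.
rewrite nE lecR; apply: (@le0_small _ _ 2) => e e0.
have e0' : (0 : R[i]) < e%:C by rewrite ltcR.
have [p hp] := h _ e0'; have [q hq] := ip2_cdot x y e0'.
have := hp _ (leq_maxl p q); have := hq _ (leq_maxr p q); set z := psumC _ _ => h1 h2.
rewrite -lecR -nE.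
have -> : s - cdot x y = (s - z) + (z - cdot x y) by rewrite addrA subrK.
apply: le_trans (ler_normD _ _) _; rewrite distrC.
by rewrite rmorphM /= (_ : 2%:C = 2 :> R[i]) ?rmorph_nat // mulr_natl mulr2n lerD // ltW.
Qed.

(** * Operators on $L^2$ and their quadratic forms *)

Definition linearH (T : l2 -> l2) := forall c x y, T (c *: x + y) = c *: T x + T y.

Lemma linearHD T : linearH T -> {morph T : x y / x + y}.
Proof. by move=> lT x y; rewrite -[x]scale1r lT !scale1r. Qed.

Lemma linearH0 T : linearH T -> T 0 = 0.
Proof. by move=> /linearHD TD; apply: (addIr (T 0)); rewrite -TD !add0r. Qed.

Lemma linearHZ T c x : linearH T -> T (c *: x) = c *: T x.
Proof. by move=> lT; rewrite -[c *: x]addr0 lT linearH0 // addr0. Qed.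

Lemma linearHB T : linearH T -> {morph T : x y / x - y}.
Proof. by move=> lT x y; rewrite linearHD // -[- y]scaleN1r linearHZ // scaleN1r. Qed.

Lemma op_lift T : bounded_op ip T -> exists TH : l2 -> l2,
  [/\ forall x : l2, T x = TH x :> (int -> K), linearH TH
    & exists2 c, 0 <= c & forall x, sqnorm (TH x) <= c * sqnorm x].
Proof.
move=> [T_in T_lin [c Tc]].
have [x|TH THE] := @choice l2 l2 (fun x z => T x = z :> (int -> K)).
  exact/l2_of_inL2/T_in/inL2_l2.
exists TH; split=> //.
  move=> d x y; apply: val_inj; rewrite /= -THE.
  have := T_lin d x y (inL2_l2 x) (inL2_l2 y); rewrite !THE => E; exact: E.
(* The constant in [bounded_op] carries no sign, so it is replaced by its maximum with 0. *)
exists (Num.max c 0) => [|x]; first by rewrite le_max lexx orbT.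
apply: sqnorm_le => n; rewrite -THE; apply: le_trans (Tc x (inL2_l2 x) (sqnorm x) _ n) _.
  exact: psumR_le_sqnorm.
by rewrite ler_wpM2r ?sqnorm_ge0 // le_max lexx.
Qed.

Lemma toeplitz_lift T (TH : l2 -> l2) : toeplitz ip T -> (forall x : l2, T x = TH x :> (int -> K)) ->
  linearH TH -> forall g k, l2sym g k -> forall x, TH (g x) = g (TH x).
Proof.
move=> [_ Tsh] THE lT.
have sh x : TH (shiftH x) = shiftH (TH x).
  by apply: val_inj; rewrite /= -!THE -Tsh //; exact: inL2_l2.
move=> g k [c c0||] x; [exact: linearHZ|exact: sh|].
by rewrite -[LHS]shiftHK -sh unshiftHK.
Qed.

(** The map on all sequences induced by [T], with default value 0 outside $L^2$. *)
Definition op_of (T : l2 -> l2) : op K :=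
  fun x => if pselect (inL2 ip x) is left h then T (L2Seq (introT (L2P x) h)) : int -> K else 0.

Lemma op_ofE T (x : l2) : op_of T x = T x.
Proof.
rewrite /op_of; case: pselect => [h|/(_ (inL2_l2 x))//].
by congr (l2_val (T _)); apply: val_inj.
Qed.

Lemma bounded_op_of T c : linearH T -> 0 <= c ->
  (forall x, sqnorm (T x) <= c * sqnorm x) -> bounded_op ip (op_of T).
Proof.
move=> lT c0 Tc; split.
- by move=> x /l2_of_inL2[X ->]; rewrite op_ofE; exact: inL2_l2.
- move=> d x y /l2_of_inL2[X ->] /l2_of_inL2[Y ->].
  by rewrite -[fun n => _]/((d *: X + Y : l2) : int -> K) !op_ofE lT.
exists c => x /l2_of_inL2[X ->] S hS n; rewrite op_ofE.
apply: le_trans (psumR_le_sqnorm (T X) n) _; apply: le_trans (Tc X) _.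
by rewrite ler_wpM2l // sqnorm_le.
Qed.

Lemma toeplitz_op_of T c : linearH T -> 0 <= c ->
  (forall x, sqnorm (T x) <= c * sqnorm x) ->
  (forall x, T (shiftH x) = shiftH (T x)) -> toeplitz ip (op_of T).
Proof.
move=> lT c0 Tc Tsh; split; first exact: bounded_op_of Tc.
move=> x /l2_of_inL2[X ->].
by rewrite -[shift X]/(shiftH X : int -> K) !op_ofE Tsh.
Qed.

Let qN := qform_sqnorm.

Lemma dotC x y : dot x y = dot y x.
Proof. exact: (polarC l2sym_scale _ _ qN). Qed.

Lemma dotDl x x' y : dot (x + x') y = dot x y + dot x' y.
Proof. exact: (polarDl l2sym_scale _ _ _ qN). Qed.

Lemma dotDr x y y' : dot x (y + y') = dot x y + dot x y'.
Proof. exact: (polarDr l2sym_scale _ _ _ qN). Qed.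

Lemma dotBl x x' y : dot (x - x') y = dot x y - dot x' y.
Proof. exact: (polarBl l2sym_scale _ _ _ qN). Qed.

Lemma dotBr x y y' : dot x (y - y') = dot x y - dot x y'.
Proof. exact: (polarBr l2sym_scale _ _ _ qN). Qed.

Lemma dotxx x : dot x x = sqnorm x.
Proof. exact: (polarxx l2sym_scale _ qN). Qed.

Lemma dot0l y : dot 0 y = 0.
Proof. by have := dotBl 0 0 y; rewrite !subrr. Qed.

Lemma dot_il x y : dot ('i%C *: x) y = - dot x ('i%C *: y).
Proof.
rewrite (polar_adj l2symD l2sym_scale _ _ _ qN sqnorm_ge0).
have -> : conjc 'i%C = - 'i%C :> R[i] by rewrite /=; congr Complex; rewrite oppr0.
by rewrite scaleNr (polarNr l2sym_scale _ _ qN).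
Qed.

Lemma scale_iN (x : l2) : 'i%C *: (- 'i%C *: x) = x.
Proof. by rewrite scalerA mulrN -expr2 sqr_i opprK scale1r. Qed.

Lemma dot_le x y : dot x y <= 2^-1 * (sqnorm x + sqnorm y).
Proof. by have := sqnorm_ge0 (x - y); rewrite -dotxx dotBl !dotBr (dotC y) !dotxx; lra. Qed.

Lemma linearH_eq0 D : linearH D -> (forall x, dot (D x) x = 0) ->
  (forall x, dot (D x) ('i%C *: x) = 0) -> forall x, D x = 0.
Proof.
move=> lD re0 im0.
have E1 x y : dot (D x) y + dot (D y) x = 0.
  by have := re0 (x + y); rewrite linearHD // dotDl !dotDr !re0; lra.
have E2 x y : dot (D x) ('i%C *: y) + dot (D y) ('i%C *: x) = 0.
  by have := im0 (x + y); rewrite linearHD // scalerDr dotDl !dotDr !im0; lra.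
have E3 x z : dot (D x) z = 0.
  rewrite -[z]scale_iN; move: (- 'i%C *: z) => y.
  have := E1 x ('i%C *: y); have := E2 x y.
  by rewrite (linearHZ _ _ lD) dot_il; lra.
by move=> x; apply: sqnorm_eq0; rewrite -dotxx E3.
Qed.

(** Only the real part of $\langle Tx,x\rangle$ enters, so self-adjointness of [T] is not at
    issue. *)
Lemma qform_op T : linearH T -> (forall g k, l2sym g k -> forall x, T (g x) = g (T x)) ->
  qform (fun x => dot (T x) x).
Proof.
move=> lT Tsym; split=> [x y|g k gk x].
  by rewrite linearHD // linearHB // dotDl dotBl !dotBr !dotDr; ring.
by rewrite (Tsym _ _ gk) (polar_sym l2symD _ _ qN gk).
Qed.

Lemma bform_op T : linearH T -> (forall g k, l2sym g k -> forall x, T (g x) = g (T x)) ->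
  bform (fun x y => dot (T x) y).
Proof.
move=> lT Tsym; split=> [x x' y|x y y'|g k gk x y].
- by rewrite linearHD // dotDl.
- by rewrite dotDr.
by rewrite (Tsym _ _ gk) (polar_sym l2symD _ _ qN gk).
Qed.

(** A complex number is nonnegative when its real part is and its imaginary part vanishes. The [B]
    terms add up to $2\,\mathrm{Re}\langle Bx,y\rangle$, so the second condition involves [A] and
    [M] alone. *)
Lemma block_psdP (A B M : op K) (a b m : l2 -> l2) :
  (forall x : l2, A x = a x :> (int -> K)) -> (forall x : l2, B x = b x :> (int -> K)) ->
  (forall x : l2, M x = m x :> (int -> K)) ->
  block_psd ip A B M <->
    adm (fun x => dot (a x) x) (fun x y => dot (b x) y) (fun x => dot (m x) x) /\
    forall x y, dot (a x - m x) ('i%C *: x) + dot (m y) ('i%C *: y) = 0.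
Proof.
move=> Aa Bb Mm.
have subE (x : l2) : subop A M x = (a x - m x : l2) :> (int -> K).
  by rewrite /subop Aa Mm.
have sumE (x y : l2) : (0 <= cdot (a x - m x) x + (cdot (b x) y)^*%R + cdot (b x) y + cdot (m y) y)
  <-> 0 <= dot (a x) x - dot (m x) x + 2 * dot (b x) y + dot (m y) y /\
      dot (a x - m x) ('i%C *: x) + dot (m y) ('i%C *: y) = 0.
  rewrite -[(cdot _ _)^*%R]/(conjc _) lecE /cdot /= !dotBl; split.
    by move=> /andP[/eqP im re]; split; lra.
  by move=> [re im]; apply/andP; split; [apply/eqP|]; lra.
split=> [h|[re im]].
  have hA (x : l2) : ip2 ip (subop A M x) x (cdot (a x - m x) x) by rewrite subE; exact: ip2_cdot.
  have hB (x y : l2) : ip2 ip (B x) y (cdot (b x) y) by rewrite Bb; exact: ip2_cdot.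
  have hM (y : l2) : ip2 ip (M y) y (cdot (m y) y) by rewrite Mm; exact: ip2_cdot.
  have H (x y : l2) := (sumE x y).1 (h x y (inL2_l2 x) (inL2_l2 y) _ _ _ (hA x) (hB x y) (hM y)).
  by split=> x y; have [? ?] := H x y.
move=> _ _ /l2_of_inL2[x ->] /l2_of_inL2[y ->] s t r.
rewrite subE Bb Mm => /ip2P -> /ip2P -> /ip2P ->.
by apply/sumE; split; [exact: re|exact: im].
Qed.

Lemma tight_toeplitz_exists (A B : op K) : toeplitz ip A -> toeplitz ip B ->
  (exists M : op K, Mset ip A B M) ->
  exists Ahat : op K,
    [/\ toeplitz ip Ahat, psd ip (subop A Ahat)
      & exists Mhat : op K,
          [/\ Mset ip Ahat B Mhat,
              forall M : op K, Mset ip Ahat B M -> op_eq ip M Mhat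
            & toeplitz ip Mhat]].
Proof.
move=> HA HB [M0 [bM0 psdM0]].
have [a [Aa la [ca ca0 a_le]]] := op_lift HA.1.
have [b [Bb lb _]] := op_lift HB.1.
have [m0 [Mm0 lm0 _]] := op_lift bM0.
have a_sym := toeplitz_lift HA Aa la; have b_sym := toeplitz_lift HB Bb lb.
have [adm0 im0] := (block_psdP Aa Bb Mm0).1 psdM0.
(* Setting $x = 0$, and afterwards $y = 0$, separates the imaginary parts of the two diagonal
   blocks. *)
have m0_im y : dot (m0 y) ('i%C *: y) = 0.
  by have := im0 0 y; rewrite (linearH0 la) (linearH0 lm0) subr0 dot0l add0r.
have a_im x : dot (a x) ('i%C *: x) = 0.
  by have := im0 x 0; rewrite (linearH0 lm0) dot0l dotBl m0_im; lra.
have qa := qform_op la a_sym; have hb := bform_op lb b_sym.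
have m00 : dot (m0 0) 0 = 0 by rewrite (linearH0 lm0) dot0l.
have [ah [mh [qah qmh ah_le adm_h uniq]]] :=
  tight_form_exists l2symD l2sym_gt0 l2symV l2sym_muln (m := fun x => dot (m0 x) x) qa hb m00 adm0.
have mh0 := qform0 qmh.
have mh_ge0 := adm_ge0 qah hb mh0 adm_h.
have mh_le := adm_le hb mh0 adm_h.
have ah_ge0 x : 0 <= ah x by apply: le_trans (mh_ge0 x) (mh_le x).
(* From $\mathrm{Re}\langle ax,x\rangle \le (\|ax\|^2 + \|x\|^2)/2$ and $\|ax\|^2 \le
   ca\,\|x\|^2$. *)
pose c := 2^-1 * (ca + 1).
have c0 : 0 <= c by rewrite /c; lra.
have ah_bound x : ah x <= c * sqnorm x.
  apply: le_trans (ah_le x) _; apply: le_trans (dot_le _ _) _.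
  by have := a_le x; rewrite /c; lra.
have rep q : qform q -> (forall x, 0 <= q x) -> (forall x, q x <= c * sqnorm x) ->
    exists T, [/\ toeplitz ip (op_of T), linearH T, forall x, dot (T x) x = q x
      & forall x, dot (T x) ('i%C *: x) = 0].
  move=> qq q0 qc; have [T [TD Tsym TE Tc]] := form_operator l2symD l2symV l2sym_scale
    qN sqnorm_ge0 sqnorm_eq0 sqnorm_complete qq q0 c0 qc.
  have lT : linearH T.
    move=> d x y; rewrite TD; congr (_ + _); have [->|d0] := eqVneq d 0.
      by rewrite !scale0r; apply: (addIr (T 0)); rewrite -TD !add0r.
    exact: (Tsym _ _ (l2sym_scale d0)).
  exists T; split=> // [|x|x].
  - by apply: toeplitz_op_of Tc _; rewrite ?sqr_ge0 //; exact: Tsym l2sym_shift.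
  - by rewrite dotC -TE (polarxx l2sym_scale _ qq).
  - rewrite dotC -TE (polarC l2sym_scale _ _ qq).
    exact: (polar_i l2symD l2sym_scale _ qq q0).
have [Ta [toepA lTa Ta_re Ta_im]] := rep _ qah ah_ge0 ah_bound.
have [|Tm [toepM lTm Tm_re Tm_im]] := rep _ qmh mh_ge0 _.
  by move=> x; apply: le_trans (mh_le x) (ah_bound x).
exists (op_of Ta); split=> //.
  move=> _ /l2_of_inL2[x ->] s.
  have -> : subop A (op_of Ta) x = (a x - Ta x : l2) :> (int -> K).
    by rewrite /subop Aa op_ofE.
  move=> /ip2P ->; rewrite lecE /cdot /= !dotBl a_im Ta_im subrr eqxx /= Ta_re.
  by have := ah_le x; lra.
exists (op_of Tm); split=> //.
  split; first exact: toepM.1.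
  apply/(block_psdP (op_ofE Ta) Bb (op_ofE Tm)); split=> x y.
    by rewrite Ta_re !Tm_re; exact: adm_h.
  by rewrite dotBl Ta_im !Tm_im; lra.
move=> M [bM psdM] _ /l2_of_inL2[x ->].
have [m [Mm lm _]] := op_lift bM.
have [adm_m im_m] := (block_psdP (op_ofE Ta) Bb Mm).1 psdM.
have m_im y : dot (m y) ('i%C *: y) = 0.
  by have := im_m 0 y; rewrite (linearH0 lTa) (linearH0 lm) subr0 dot0l add0r.
(* [M] is any bounded operator, so its form need not be shift invariant; uniqueness against
   arbitrary functions covers it. *)
have m_re y : dot (m y) y = mh y.
  apply: (uniq (fun y => dot (m y) y)); first by rewrite (linearH0 lm) dot0l.
  by move=> z w; have := adm_m z w; rewrite Ta_re.
rewrite Mm op_ofE; congr l2_val; apply/eqP; rewrite -subr_eq0; apply/eqP.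
apply: (@linearH_eq0 (fun x => m x - Tm x)) => [d z w|z|z].
- by rewrite lm lTm scalerBr opprD addrACA.
- by rewrite dotBl m_re Tm_re subrr.
- by rewrite dotBl m_im Tm_im subrr.
Qed.
End L2.

Theorem theorem4p5 (R : realType) (K : lmodType R[i]) (ip : K -> K -> R[i])
  (HK : is_hilbert ip) (A B : op K)
  (HA : toeplitz ip A) (HB : toeplitz ip B)
  (Hne : exists M : op K, Mset ip A B M) :
  exists Ahat : op K,
    [/\ toeplitz ip Ahat, psd ip (subop A Ahat)
      & exists Mhat : op K,
          [/\ Mset ip Ahat B Mhat,
              forall M : op K, Mset ip Ahat B M -> op_eq ip M Mhat
            & toeplitz ip Mhat]].
Proof. exact: tight_toeplitz_exists. Qed.
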